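(* Let $n\ge 2$, and let $D_1$ and $D_2$ be the first and second Spencer operators of the Lie algebra of infinitesimal isometries of the Euclidean metric on $\mathbb{R}^n$, written out in the context. Then: (1) The homogeneous Cosserat (stress/couple-stress) equations $$\partial_i\sigma^{ij}=0\quad(1\le j\le n),\qquad \partial_r\mu^{r,ij}+\sigma^{ij}-\sigma^{ji}=0\quad(1\le i<j\le n),$$ in which the $\sigma^{ij}$ are not assumed symmetric and $\mu^{r,ij}=-\mu^{r,ji}$, are, up to an overall sign, the equations $\mathrm{ad}(D_1)(\sigma,\mu)=0$. (2) These equations are parametrized by the first order operator $\mathrm{ad}(D_2)$, which acts on $n^2(n^2-1)/4$ arbitrary functions (pseudo-potentials). That is, $\mathrm{ad}(D_1)\circ\mathrm{ad}(D_2)=0$ and $\mathrm{ad}(D_1)$ generates all the compatibility conditions of $\mathrm{ad}(D_2)$. (3) For $n=2$ this parametrization, by three functions $\phi^1,\phi^2,\phi^3$, is $$\sigma^{11}=-\partial_2\phi^1,\quad \sigma^{12}=-\partial_2\phi^2,\quad \sigma^{21}=\partial_1\phi^1,\quad \sigma^{22}=\partial_1\phi^2,$$ $$\mu^{1,12}=-\partial_2\phi^3+\phi^1,\quad \mu^{2,12}=\partial_1\phi^3+\phi^2 .$$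
   Context: Repeated indices are summed from $1$ to $n$, and $\partial_i=\partial/\partial x^i$ on $\mathbb{R}^n$. Indices are raised and lowered with the constant Euclidean metric. All operators are linear with constant real coefficients, i.e. matrices over the commutative ring $\mathbb{R}[\partial_1,\dots,\partial_n]$. **Operator $D_1$.** The unknowns are functions $\xi_i$ ($1\le i\le n$) and $\xi_{i,j}=-\xi_{j,i}$ ($1\le i,j\le n$), i.e. sections of the bundle $R_1$ of rank $n(n+1)/2$; the independent ones are $\xi_i$ and $\xi_{i,j}$ with $i<j$. Then $D_1$ maps $(\xi_i,\xi_{i,j})$ to $(A_{ij},B_{r,ij})$, where $$A_{ij}=\partial_i\xi_j-\xi_{i,j},\qquad B_{r,ij}=\partial_r\xi_{i,j}=-B_{r,ji}.$$ The independent target components are the $A_{ij}$ for all $i,j$ and the $B_{r,ij}$ for all $r$ and $i<j$. **Operator $D_2$.** It maps $(A_{ij},B_{r,ij})$, with $B_{r,ij}=-B_{r,ji}$, to the components $$\partial_jA_{ik}-\partial_iA_{jk}+B_{j,ik}-B_{i,jk}\quad(i<j,\ 1\le k\le n),\qquad \partial_jB_{i,kl}-\partial_iB_{j,kl}\quad(i<j,\ k<l).$$ Their number is $\frac{n(n-1)}{2}\cdot\frac{n(n+1)}{2}=\frac{n^2(n^2-1)}{4}$. For $n=2$, with $B_1=B_{1,12}$ and $B_2=B_{2,12}$, these components, in the order dual to $\phi^1,\phi^2,\phi^3$, are $\partial_2A_{11}-\partial_1A_{21}+B_1$, $\partial_2A_{12}-\partial_1A_{22}+B_2$, $\partial_2B_1-\partial_1B_2$.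 **Formal adjoint.** For a matrix operator $P$ over $\mathbb{R}[\partial_1,\dots,\partial_n]$, $\mathrm{ad}(P)$ is the transposed matrix with each $\partial_i$ replaced by $-\partial_i$; equivalently, $\lambda\cdot P\xi=(\mathrm{ad}(P)\lambda)\cdot\xi$ modulo a divergence. For $D_1$ the test functions dual to $A_{ij}$ and to $B_{r,ij}$ ($i<j$) are denoted $\sigma^{ij}$ and $\mu^{r,ij}$; for $D_2$ the test functions dual to its target components are the potentials. **Compatibility conditions and parametrization.** A compatibility condition of a matrix operator $Q$ is a row vector $P$ of differential operators in $\mathbb{R}[\partial_1,\dots,\partial_n]$ with $P\circ Q=0$. An operator $S$ generates the compatibility conditions of $Q$ if $S\circ Q=0$ and every compatibility condition $P$ of $Q$ has the form $P=P'\circ S$ for some row vector $P'$ over the same ring. The system $Sy=0$ is said to be parametrized by $Q$ when $S$ generates the compatibility conditions of $Q$. *)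

(* Defs.v *)
From mathcomp Require Import all_boot all_order all_algebra.
From mathcomp Require Import reals.
From mathcomp.multinomials Require Import mpoly.

Set Implicit Arguments.
Unset Strict Implicit.
Unset Printing Implicit Defensive.

Import GRing.Theory.
Local Open Scope ring_scope.

(** {mpoly R[n]} is the ring R[d_1, ..., d_n] of constant coefficient
    differential operators, 'X_i standing for d_i.  A left module M over it is
    any space of "functions" on which these operators act (smooth functions,
    distributions, formal series, the ring itself, ...). *)

Notation lt_pair n := {p : 'I_n * 'I_n | (p.1 < p.2)%N}.

(** Independent components: (xi_i ; xi_{i,j}, i < j). *)
Notation R1_idx n := ('I_n + lt_pair n)%type.
(** Independent components: (A_{ij} ; B_{r,ij}, i < j). *)
Notation AB_idx n := ('I_n * 'I_n + 'I_n * lt_pair n)%type.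
(** Components of the target of D_2: (i < j, k ; i < j, k < l). *)
Notation D2_idx n := (lt_pair n * 'I_n + lt_pair n * lt_pair n)%type.

Section Operators.
Variables (R : realType) (n : nat).
Local Notation D := {mpoly R[n]}.

(** The rows (resp. columns) of the matrix of an operator are numbered by the
    enumeration of the finite type J (resp. I) of its target (resp. source)
    components. *)
Local Notation "''Op_' ( J , I )" := 'M[D]_(#|{: J}|, #|{: I}|)
  (at level 8, format "''Op_' ( J ,  I )").

Definition pd (M : lmodType D) (i : 'I_n) (x : M) : M := ('X_i : D) *: x.

Definition op_act (I J : finType) (P : 'Op_(J, I)) (M : lmodType D)
    (x : I -> M) (j : J) : M :=
  \sum_(i : I) P (enum_rank j) (enum_rank i) *: x i.

(** The matrix whose columns are the images of the unit vectors under F. *)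
Definition op_mx (I J : finType) (F : (I -> D^o) -> J -> D^o) : 'Op_(J, I) :=
  \matrix_(a, b) (F (fun i => (i == enum_val b)%:R) (enum_val a) : D).

Definition ad (a b : nat) (P : 'M[D]_(a, b)) : 'M[D]_(b, a) :=
  map_mx (fun p : D => p \mPo [tuple - ('X_i : D) | i < n]) P^T.

(** msize is the total degree plus one; the zero operator gets order 0. *)
Definition op_order (a b : nat) (P : 'M[D]_(a, b)) : nat :=
  (\max_(i < a) \max_(j < b) msize (P i j)).-1.

Definition generates_cc (a b c : nat) (S : 'M[D]_(c, b)) (Q : 'M[D]_(b, a)) :=
  S *m Q = 0 /\
  forall P : 'rV[D]_b, P *m Q = 0 -> exists P' : 'rV[D]_c, P = P' *m S.

(** The system S y = 0 is parametrized by Q. *)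
Definition parametrized_by (a b c : nat)
  (S : 'M[D]_(c, b)) (Q : 'M[D]_(b, a)) := generates_cc S Q.

(** The family f_{ij} = - f_{ji} with prescribed components for i < j. *)
Definition asym (M : lmodType D) (f : lt_pair n -> M) (i j : 'I_n) : M :=
  if insub (i, j) is Some p then f p
  else if insub (j, i) is Some p then - f p
  else 0.

Definition D1_fun (M : lmodType D) (xi : R1_idx n -> M) (t : AB_idx n) : M :=
  let xi1 i := xi (inl i) in
  let xi2 := asym (fun p => xi (inr p)) in
  match t with
  | inl (i, j) => pd i (xi1 j) - xi2 i j
  | inr (r, p) => pd r (xi2 (val p).1 (val p).2)
  end.

Definition D2_fun (M : lmodType D) (ab : AB_idx n -> M) (t : D2_idx n) : M :=
  let A i j := ab (inl (i, j)) in
  let B r := asym (fun p => ab (inr (r, p))) in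
  match t with
  | inl (p, k) => let: (i, j) := val p in
      pd j (A i k) - pd i (A j k) + B j i k - B i j k
  | inr (p, q) => let: (i, j) := val p in let: (k, l) := val q in
      pd j (B i k l) - pd i (B j k l)
  end.

Definition D1 : 'Op_(AB_idx n, R1_idx n) := op_mx (@D1_fun D^o).
Definition D2 : 'Op_(D2_idx n, AB_idx n) := op_mx (@D2_fun D^o).

(** (sigma^{ij}, mu^{r,ij}) as the family dual to (A_{ij} ; B_{r,ij}, i < j). *)
Definition stress (M : lmodType D) (sigma : 'I_n -> 'I_n -> M)
    (mu : 'I_n -> 'I_n -> 'I_n -> M) (t : AB_idx n) : M :=
  match t with
  | inl (i, j) => sigma i j
  | inr (r, p) => mu r (val p).1 (val p).2
  end.

(** Left hand sides of the Cosserat equations. *)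
Definition cosserat (M : lmodType D) (sigma : 'I_n -> 'I_n -> M)
    (mu : 'I_n -> 'I_n -> 'I_n -> M) (u : R1_idx n) : M :=
  match u with
  | inl j => \sum_(i < n) pd i (sigma i j)
  | inr p => let: (i, j) := val p in
      \sum_(r < n) pd r (mu r i j) + sigma i j - sigma j i
  end.

(** D1 and D2, as matrices, act on every module by the defining formulas. *)
Section Action.
Variable M : lmodType D.

Lemma sum_pick (I : finType) (x : I -> M) (i : I) :
  \sum_k ((i == k)%:R : D) *: x k = x i.
Proof.
rewrite (bigD1 i) //= eqxx scale1r big1 ?addr0 // => k /negPf ki.
by rewrite eq_sym ki scale0r.
Qed.

Lemma sum_pd (I : finType) (x : I -> M) (c : I -> D^o) (r : 'I_n) :
  \sum_k (pd r (c k) : D) *: x k = pd r (\sum_k (c k : D) *: x k).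
Proof.
by rewrite /pd scaler_sumr; apply: eq_bigr => k _; rewrite scalerA.
Qed.

Lemma sum_asym (I : finType) (h : lt_pair n -> I) (x : I -> M) (i j : 'I_n) :
  \sum_k (asym (fun p => (h p == k)%:R : D^o) i j : D) *: x k
  = asym (fun p => x (h p)) i j.
Proof.
rewrite /asym; case: insub => [p|]; first exact: sum_pick.
case: insub => [p|].
  by under eq_bigr do rewrite scaleNr; rewrite sumrN sum_pick.
by rewrite big1 // => k _; rewrite scale0r.
Qed.

Let sumB (I : finType) (x : I -> M) (c d : I -> D) :
  \sum_k (c k - d k) *: x k = \sum_k c k *: x k - \sum_k d k *: x k.
Proof. by rewrite -sumrB; apply: eq_bigr => k _; rewrite scalerBl. Qed.

Let sumD (I : finType) (x : I -> M) (c d : I -> D) :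
  \sum_k (c k + d k) *: x k = \sum_k c k *: x k + \sum_k d k *: x k.
Proof. by rewrite -big_split; apply: eq_bigr => k _; rewrite scalerDl. Qed.

Lemma D1E (xi : R1_idx n -> M) t : op_act D1 xi t = D1_fun xi t.
Proof.
rewrite /op_act; under eq_bigr do rewrite mxE !enum_rankK.
case: t => [[i j]|[r p]] /=.
  rewrite sumB sum_pd sum_pick.
  by rewrite (sum_asym (fun p => inr p : R1_idx n)).
by rewrite sum_pd (sum_asym (fun p => inr p : R1_idx n)).
Qed.

Lemma D2E (ab : AB_idx n -> M) t : op_act D2 ab t = D2_fun ab t.
Proof.
have asymE r := sum_asym (fun p => inr (r, p) : AB_idx n) ab.
rewrite /op_act; under eq_bigr do rewrite mxE !enum_rankK.
case: t => [[[[i j] ij] k]|[[[i j] ij] [[k l] kl]]] /=.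
  by rewrite sumB sumD sumB !sum_pd !sum_pick !asymE.
by rewrite sumB !sum_pd !asymE.
Qed.

End Action.
End Operators.

Section PlaneIndices.
Definition one2 : 'I_2 := ord0.
Definition two2 : 'I_2 := ord_max.
Definition p12 : lt_pair 2 := exist _ (one2, two2) isT.

Definition potentials2 (R : realType) (M : lmodType {mpoly R[2]})
    (phi1 phi2 phi3 : M) (t : D2_idx 2) : M :=
  match t with
  | inl (_, k) => if k == one2 then phi1 else phi2
  | inr _ => phi3
  end.
End PlaneIndices.

(* Main.v *)
(**
  The formal adjoint is an involution reversing products, so a compatibility
  condition P of ad(D_2) is the same thing as a vector ad(P) over
  R[d_1, ..., d_n] killed by D_2, and the second claim says that the sequence
  D_1, D_2 is exact over this ring.  This is Koszul exactness used twice
  (n >= 2 is needed here): the equations d_j B_{i,kl} = d_i B_{j,kl} force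
  B_{r,kl} = d_r xi_{k,l}, and the remaining ones then say that
  d_j (A_{ik} + xi_{i,k}) is symmetric in i and j, so that
  A_{ik} + xi_{i,k} = d_i xi_k.
*)

Require Import Defs.
From mathcomp Require Import all_boot all_order all_algebra.
From mathcomp Require Import reals.
From mathcomp.multinomials Require Import mpoly.

Import GRing.Theory.
Local Open Scope ring_scope.

(** * Koszul exactness in degree one over a polynomial ring *)

Section MultivariatePolynomials.
Variables (R : idomainType) (n : nat).
Implicit Types (p : {mpoly R[n]}) (i j : 'I_n).

Lemma mpolyX1_neq0 i : 'X_i != 0 :> {mpoly R[n]}.
Proof. by rewrite -msize_poly_eq0 msizeX. Qed.

Lemma mcoeffMX_eq0 p i (m : 'X_{1..n}) :
  m i = 0%N -> (p * 'X_i)@_m = 0.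
Proof.
move=> mi0; apply: memN_msupp_eq0; rewrite (perm_mem (msuppMX p U_(i)%MM)).
apply/negP => /mapP[m' _ def_m]; move: mi0.
by rewrite def_m mnmDE mnm1E eqxx.
Qed.

Lemma mpolyX_dvd p i :
  (forall m : 'X_{1..n}, m i = 0%N -> p@_m = 0) -> exists q, p = 'X_i * q.
Proof.
(* The quotient lowers the exponent of ['X_i] by one in every monomial; the truncated subtraction is
   exact because this exponent is positive throughout the support. *)
move=> p_i0; exists (\sum_(m <- msupp p) p@_m *: 'X_[m - U_(i)]).
rewrite {1}(mpolyE p) mulr_sumr; apply: eq_big_seq => m.
rewrite mcoeff_msupp => pm_neq0; rewrite -scalerAr -mpolyXD addmC submK //.
by rewrite lep1mP; apply: contraNneq pm_neq0 => /p_i0->.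
Qed.

(** Since X_0 and X_1 are distinct variables, X_1 f_0 = X_0 f_1 makes X_0 divide f_0. The quotient g
    serves every index: X_0 f_i = X_i f_0 = X_0 X_i g, and X_0 cancels. *)
Lemma koszul_exact (f : 'I_n -> {mpoly R[n]}) :
  (1 < n)%N -> (forall i j, (i < j)%N -> 'X_j * f i = 'X_i * f j) ->
  exists g, forall i, f i = 'X_i * g.
Proof.
move=> n_gt1 ltf.
have ff i j : 'X_j * f i = 'X_i * f j.
  by case: (ltngtP i j) => [/ltf//|/ltf//|/val_inj->].
pose i0 := Ordinal (ltnW n_gt1); pose i1 := Ordinal n_gt1.
have [m m0|g fi0] := mpolyX_dvd (f i0) i0.
  (* Multiplying by X_1 keeps the exponent of X_0 at zero, and no such monomial occurs in X_0
     f_1. *)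
  rewrite -(mcoeffMX (f i0) U_(i1)%MM) mulrC (ff i0 i1) mulrC.
  by rewrite mcoeffMX_eq0 // mnmDE m0 mnm1E.
exists g => i; apply: (mulfI (mpolyX1_neq0 i0)).
by rewrite (ff i i0) fi0 mulrCA.
Qed.

End MultivariatePolynomials.

(** * The formal adjoint, duality, and antisymmetric families *)

Section FormalAdjoint.
Variables (R : realType) (n : nat).
Local Notation D := {mpoly R[n]}.
Local Notation negX := [tuple - ('X_i : D) | i < n].

Lemma comp_negX i : ('X_i : D) \mPo negX = - 'X_i.
Proof. by rewrite comp_mpolyXU -tnth_nth tnth_mktuple. Qed.

Lemma comp_negXK (p : D) : (p \mPo negX) \mPo negX = p.
Proof.
elim/mpolyind: p => [|c m p _ _ IHp]; first by rewrite !comp_mpoly0.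
rewrite !comp_mpolyD !comp_mpolyZ IHp; congr (_ *: _ + _).
rewrite comp_mpolyX rmorph_prod [RHS]mpolyXE_id; apply: eq_bigr => i _.
by rewrite rmorphXn tnth_mktuple rmorphN /= comp_negX opprK.
Qed.

Lemma adK a b (P : 'M[D]_(a, b)) : ad (ad P) = P.
Proof. by apply/matrixP => i j; rewrite !mxE comp_negXK. Qed.

(** Constant coefficients make the entries commute, so transposition reverses products, and the
    substitution of [- 'X_i] is a ring morphism. *)
Lemma ad_mul a b c (P : 'M[D]_(a, b)) (Q : 'M[D]_(b, c)) :
  ad (P *m Q) = ad Q *m ad P.
Proof.
apply/matrixP => i j; rewrite !mxE rmorph_sum.
by apply: eq_bigr => k _; rewrite !mxE rmorphM mulrC.
Qed.

Lemma ad0 a b : ad (0 : 'M[D]_(a, b)) = 0.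
Proof. by apply/matrixP => i j; rewrite !mxE comp_mpoly0. Qed.

Lemma op_act_ad (I J : finType) (P : 'M[D]_(#|{: J}|, #|{: I}|))
    (M : lmodType D) (y : J -> M) (i : I) :
  op_act (ad P) y i
  = \sum_j (P (enum_rank j) (enum_rank i) \mPo negX) *: y j.
Proof. by apply: eq_bigr => j _; rewrite !mxE. Qed.

(** Passes from families indexed by components to the columns on which matrix products act. *)
Definition col_of (I : finType) (x : I -> D^o) : 'cV[D]_#|{: I}| :=
  \col_k x (enum_val k).

Lemma col_of_act (I J : finType) (P : 'M[D]_(#|{: J}|, #|{: I}|))
    (x : I -> D^o) :
  col_of _ (op_act P x) = P *m col_of _ x.
Proof.
apply/colP => j; rewrite !mxE /op_act (reindex_onto enum_val enum_rank) /=.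
  by apply: eq_big => k; rewrite !enum_valK ?eqxx // mxE.
by move=> i _; apply: enum_rankK.
Qed.

(** Duality: a row [P] with [P *m ad Q = 0] becomes the column [ad P] killed by [Q]; exactness
    writes it as [S] applied to some [z], and a second adjoint factors [P] through [ad S]. *)
Lemma generates_cc_ad (I J K : finType) (S : 'M[D]_(#|{: J}|, #|{: K}|))
    (Q : 'M[D]_(#|{: I}|, #|{: J}|)) :
  (forall (x : K -> D^o) i, op_act Q (op_act S x) i = 0) ->
  (forall x : J -> D^o, (forall i, op_act Q x i = 0) ->
     exists z : K -> D^o, forall j, x j = op_act S z j) ->
  generates_cc (ad S) (ad Q).
Proof.
move=> QS0 exQ; split.
  rewrite -ad_mul; suff -> : Q *m S = 0 by rewrite ad0.
  apply/matrixP => a b.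
  (* Acting on the unit vector [b] extracts column [b] of [Q *m S]. *)
  have := QS0 (fun k => (k == enum_val b)%:R) (enum_val a).
  have -> x i : op_act Q (op_act S x) i
      = (col_of _ (op_act Q (op_act S x))) (enum_rank i) 0.
    by rewrite mxE enum_rankK.
  rewrite !col_of_act mulmxA enum_valK.
  set e := col_of _ _; have -> : e = delta_mx b 0.
    by apply/colP => k; rewrite !mxE (inj_eq enum_val_inj) andbT.
  by rewrite -colE !mxE.
move=> P PQ0.
have QP0 : Q *m ad P = 0 by rewrite -[Q]adK -ad_mul PQ0 ad0.
have colad : col_of _ (fun j => ad P (enum_rank j) 0) = ad P.
  by apply/colP => k; rewrite mxE enum_valK.
have [i|z Pz] := exQ (fun j => ad P (enum_rank j) 0).
  have /colP/(_ (enum_rank i)) :=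
    col_of_act _ _ Q (fun j => ad P (enum_rank j) 0).
  by rewrite colad QP0 !mxE enum_rankK.
exists (ad (col_of _ z)); rewrite -ad_mul -[LHS]adK -col_of_act; congr (ad _).
by apply/colP => k; rewrite [RHS]mxE -Pz enum_valK.
Qed.

(* [Defs.lt_pair] is qualified because [order] also exports an [lt_pair]. *)
Lemma asym_delta (p : Defs.lt_pair n) (i j : 'I_n) :
  asym (fun q => (q == p)%:R : D^o) i j
  = ((i, j) == val p)%:R - ((j, i) == val p)%:R.
Proof.
rewrite /asym; case: insubP => [q lt_ij def_q|ge_ij].
  rewrite -val_eqE def_q [X in _ - X](_ : _ = 0) ?subr0 //.
  case: eqP => // ji; have := valP p.
  by rewrite -ji /= ltnNge ltnW.
have -> : ((i, j) == val p) = false.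
  by apply: contraNF ge_ij => /eqP->; apply: (valP p).
rewrite sub0r; case: insubP => [q lt_ji def_q|ge_ji].
  by rewrite -val_eqE def_q.
suff -> : ((j, i) == val p) = false by rewrite oppr0.
by apply: contraNF ge_ji => /eqP->; apply: (valP p).
Qed.

Lemma asym0 (i j : 'I_n) : asym (fun=> 0 : D^o) i j = 0.
Proof.
by rewrite /asym; case: insub => //; case: insub => // _; rewrite oppr0.
Qed.

Lemma asym_lt (M : lmodType D) (f : Defs.lt_pair n -> M) (p : Defs.lt_pair n) :
  asym f (val p).1 (val p).2 = f p.
Proof.
rewrite /asym (_ : insub _ = Some p) //.
by case: p => [[i j] /= ij]; rewrite insubT.
Qed.

Lemma pd_asym (M : lmodType D) (f : Defs.lt_pair n -> M) r i j :
  asym (fun p => pd r (f p)) i j = pd r (asym f i j).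
Proof.
rewrite /asym /pd; case: insub => //.
by case: insub => [p|]; rewrite ?scalerN ?scaler0.
Qed.

Lemma eq_asym (M : lmodType D) (f g : Defs.lt_pair n -> M) i j :
  f =1 g -> asym f i j = asym g i j.
Proof.
move=> fg; rewrite /asym.
by case: insub => [p|]; [|case: insub => [p|//]]; rewrite fg.
Qed.

End FormalAdjoint.

(** * Exactness of the Spencer sequence; the adjoint of D_1; number of potentials and order of
    ad(D_2) *)

Section Spencer.
Variables (R : realType) (n : nat).
Local Notation D := {mpoly R[n]}.
Local Notation negX := [tuple - ('X_i : D) | i < n].

(** Derivatives commute, and the terms in xi_{i,k} brought in by A cancel against those brought in
    by B. *)
Lemma D2_D1 (M : lmodType D) (xi : R1_idx n -> M) t :
  op_act (D2 R n) (op_act (D1 R n) xi) t = 0.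
Proof.
have pdC i j (x : M) : pd i (pd j x) = pd j (pd i x).
  by rewrite /pd !scalerA mulrC.
have pdB i (x y : M) : pd i (x - y) = pd i x - pd i y by rewrite /pd scalerBr.
have asymE r i j : asym (fun p => op_act (D1 R n) xi (inr (r, p))) i j
    = pd r (asym (fun p => xi (inr p)) i j).
  by rewrite -pd_asym; apply: eq_asym => p; rewrite D1E /= asym_lt.
rewrite D2E; case: t => [[[[i j] ij] k]|[[[i j] ij] [[k l] kl]]] /=.
  rewrite !asymE !D1E /= !pdB pdC.
  by rewrite opprB [X in X + _ - _]addrC addrA !subrK subrr.
by rewrite !asymE pdC subrr.
Qed.

Lemma D2_exact (x : AB_idx n -> D^o) :
  (1 < n)%N -> (forall t, op_act (D2 R n) x t = 0) ->
  exists xi : R1_idx n -> D^o, forall t, x t = op_act (D1 R n) xi t.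
Proof.
move=> n_gt1 D2x.
(* Koszul exactness, one pair k < l at a time, gives the potential xi_{k,l} of B_{r,kl}. *)
have /fin_all_exists [xi2 xi2E] (p : Defs.lt_pair n) :
    exists g : D, forall r, x (inr (r, p)) = 'X_r * g :> D.
  apply: koszul_exact => // i j ij.
  have := D2x (inr (exist _ (i, j) ij, p)); rewrite D2E /=.
  case: p => [[k l] kl] /=.
  have asymE r := asym_lt _ _ _ (fun p => x (inr (r, p))) (exist _ (k, l) kl).
  by rewrite !asymE => /eqP; rewrite subr_eq0 => /eqP.
have asymE r i j : asym (fun p => x (inr (r, p))) i j
    = pd r (asym (fun p => xi2 p : D^o) i j).
  by rewrite -pd_asym; apply: eq_asym => p; apply: xi2E.
have /fin_all_exists [xi1 xi1E] (k : 'I_n) :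
    exists g : D, forall i,
      (x (inl (i, k)) + asym (fun p => xi2 p : D^o) i k : D) = 'X_i * g :> D.
  apply: koszul_exact => // i j ij.
  (* With B_r = d_r xi inserted, this component of D_2 reads d_j f_i = d_i f_j for f_i = A_{ik} +
     xi_{i,k}. *)
  have := D2x (inl (exist _ (i, j) ij, k)); rewrite D2E /= !asymE => D2x0.
  apply/eqP; rewrite -subr_eq0 -D2x0 !mulrDr opprD addrACA addrA.
  by apply/eqP; congr (_ - _); rewrite -!addrA; congr (_ + _); apply: addrC.
exists (fun u => match u with inl i => xi1 i | inr p => xi2 p end).
case=> [[i j]|[r p]]; rewrite D1E /=.
  by apply/eqP; rewrite eq_sym subr_eq; apply/eqP; rewrite -[LHS]xi1E.
by rewrite asym_lt; apply: xi2E.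
Qed.

(** Read off the columns of [D1]: xi_j enters through d_i xi_j only, hence the divergence of sigma;
    xi_{i,j} enters A_{ij} and A_{ji} with opposite signs, hence the skew part of sigma, and
    B_{r,ij}, hence the divergence of mu. *)
Lemma D1_adjoint (M : lmodType D) (sigma : 'I_n -> 'I_n -> M)
    (mu : 'I_n -> 'I_n -> 'I_n -> M) (u : R1_idx n) :
  op_act (ad (D1 R n)) (stress sigma mu) u = - cosserat sigma mu u.
Proof.
have pick (I : finType) (i : I) (x : I -> M) :
    \sum_k ((k == i)%:R : D) *: x k = x i.
  by under eq_bigr do rewrite eq_sym; apply: sum_pick.
have comp_nat b : (b%:R : D) \mPo negX = b%:R by rewrite rmorph_nat.
rewrite op_act_ad; under eq_bigr do rewrite mxE !enum_rankK.
rewrite big_sumType /=; case: u => [j|p] /=.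
  rewrite [X in _ + X]big1 ?addr0 => [|[r q] _ /=]; last first.
    by rewrite asym0 /pd scaler0 comp_mpoly0 scale0r.
  rewrite (eq_bigr (fun t => (t.2 == j)%:R *: - pd t.1 (sigma t.1 t.2))).
    rewrite -(pair_bigA _ (fun i k => (k == j)%:R *: - pd i (sigma i k))) /=.
    by rewrite -sumrN; apply: eq_bigr => i _; rewrite pick.
  case=> i k _ /=; rewrite asym0 subr0 rmorphM /= comp_negX comp_nat.
  by rewrite (inj_eq inl_inj) mulNr scaleNr scalerN mulrC -scalerA.
(* The antisymmetric extension of the unit vector at [p] is 1 at [p] and -1 at the swapped pair; A
   carries it with a minus sign. *)
rewrite (eq_bigr (fun t : 'I_n * 'I_n => (t == ((val p).2, (val p).1))%:R
    *: sigma t.1 t.2 - (t == val p)%:R *: sigma t.1 t.2)); last first.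
  case=> i k _ /=; rewrite -scalerBl /pd scaler0 sub0r.
  rewrite (eq_asym _ _ _ _ (fun q : Defs.lt_pair n => (q == p)%:R)); last first.
    by move=> q; rewrite (inj_eq inr_inj).
  rewrite asym_delta rmorphN rmorphB /= !comp_nat opprB.
  by case: (val p) => a b; rewrite !xpair_eqE andbC.
rewrite sumrB !pick.
rewrite (eq_bigr (fun t => (t.2 == p)%:R
    *: - pd t.1 (mu t.1 (val t.2).1 (val t.2).2))); last first.
  case=> r q _ /=; rewrite asym_lt (inj_eq inr_inj) rmorphM /= comp_negX comp_nat.
  by rewrite mulNr scaleNr scalerN mulrC -scalerA.
rewrite -(pair_bigA _ (fun r q => (q == p)%:R
    *: - pd r (mu r (val q).1 (val q).2))) /=.
under [X in _ + X]eq_bigr do rewrite pick.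
by case: (val p) => i j /=; rewrite sumrN !opprD opprK addrC addrAC addrA.
Qed.

(** Counted by the larger index: j has j smaller indices. *)
Lemma card_lt_pair : #|{: Defs.lt_pair n}| = 'C(n, 2).
Proof.
rewrite card_sig -sum1_card.
rewrite -(pair_big_dep xpredT (fun i j : 'I_n => (i < j)%N) (fun _ _ => 1%N)) /=.
rewrite (exchange_big_dep xpredT) //= -bin2_sum big_mkord; apply: eq_bigr => j _.
rewrite (big_ord_narrow (ltnW (ltn_ord j))) /=.
by rewrite sum_nat_const card_ord muln1.
Qed.

(** The factor 4 avoids division: doubling both factors of C(n,2) (n + C(n,2)) gives n(n-1) times
    n(n+1). *)
Lemma card_D2_idx : (4 * #|{: D2_idx n}| = n ^ 2 * (n ^ 2 - 1))%N.
Proof.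
have C2 : ('C(n, 2) * 2 = n * n.-1)%N.
  by have := bin_ffact n 2; rewrite ffactnS ffactn1.
rewrite card_sum !card_prod card_ord card_lt_pair -mulnDr.
rewrite -[4%N]/(2 * 2)%N [LHS](_ : _ = 'C(n, 2) * 2 * (n * 2 + 'C(n, 2) * 2))%N.
  rewrite C2 -[1%N]/(1 ^ 2)%N subn_sqr subn1 addn1; case: (n) => // m /=.
  by rewrite -mulnDr add2n mulnACA mulnA.
by rewrite -mulnDl [RHS]mulnACA mulnC.
Qed.

(** Every entry combines constants and single variables, so its [msize] is at most 2, that is,
    degree at most 1; one entry attains the bound. *)
Lemma order_ad_D2 : (1 < n)%N -> op_order (ad (D2 R n)) = 1%N.
Proof.
move=> n_gt1.
have le2D (p q : D) :
    (msize p <= 2 -> msize q <= 2 -> msize (p + q) <= 2)%N.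
  by move=> p2 q2; rewrite (leq_trans (msizeD_le p q)) // geq_max p2.
have le2N (p : D) : (msize p <= 2 -> msize (- p) <= 2)%N by rewrite msizeN.
have le2nat (b : bool) : (msize (b%:R : D) <= 2)%N.
  by case: b; rewrite ?msize1 ?msize0.
have le2pd i (b : bool) : (msize (pd i (b%:R : D^o) \mPo negX) <= 2)%N.
  rewrite rmorphM /= comp_negX rmorph_nat mulNr msizeN.
  by case: b; rewrite ?mulr0 ?mulr1 ?msize0 // msizeX mdeg1.
have comp_asym r i j k : exists b c : bool,
    asym (fun p => ((inr (r, p) : AB_idx n) == k)%:R : D^o) i j = b%:R - c%:R.
  rewrite /asym; case: insub => [p|].
    by exists (inr (r, p) == k), false; rewrite subr0.
  case: insub => [p|]; last by exists false, false; rewrite subr0.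
  by exists false, (inr (r, p) == k); rewrite sub0r.
rewrite /op_order [X in X.-1](_ : _ = 2%N) //; apply/eqP; rewrite eqn_leq.
apply/andP; split.
  apply/bigmax_leqP => a _; apply/bigmax_leqP => b _.
  rewrite !mxE; case: (enum_val b) => [[[[i j] ij] k]|[[[i j] ij] [[k l] kl]]] /=.
    have [b1 [c1 ->]] := comp_asym j i k (enum_val a).
    have [b2 [c2 ->]] := comp_asym i j k (enum_val a).
    rewrite !(comp_mpolyD, comp_mpolyN) !rmorph_nat.
    have le2B p q p2 q2 := le2D p (- q) p2 (le2N q q2).
    by apply: (le2B _ _ (le2D _ _ (le2B _ _ _ _) (le2B _ _ _ _)) (le2B _ _ _ _));
      (exact: le2pd || exact: le2nat).
  rewrite (asym_lt _ _ _ _ (exist _ (k, l) kl)).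
  rewrite (asym_lt _ _ _ _ (exist _ (k, l) kl)).
  by rewrite comp_mpolyB; apply: le2D; last apply: le2N; apply: le2pd.
(* The coefficient of A_{ik} in the component with i = k = [i0] and j = [i1] is d_j, whose adjoint
   [- 'X_i1] has degree one. *)
pose i0 := Ordinal (ltnW n_gt1); pose i1 := Ordinal n_gt1.
pose a : AB_idx n := inl (i0, i0).
pose b : D2_idx n := inl (exist _ (i0, i1) isT, i0).
apply: leq_trans (leq_bigmax (enum_rank a)).
apply: leq_trans (leq_bigmax (enum_rank b)).
rewrite !mxE !enum_rankK /= !asym0 addr0 subr0.
rewrite /pd scaler0 subr0 rmorphM /= comp_negX.
by rewrite rmorph1 mulr1 msizeN msizeX mdeg1.
Qed.

End Spencer.

(** * The plane case *)

Lemma lt_pair2 (p : Defs.lt_pair 2) : p = p12.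
Proof.
apply: val_inj; case: p => [[[[|[|i]] ?] [[|[|j]] ?]] ?] //=.
by congr (_, _); apply: val_inj.
Qed.

Lemma sum_lt_pair2 (V : nmodType) (F : Defs.lt_pair 2 -> V) :
  \sum_p F p = F p12.
Proof.
by rewrite (bigD1 p12) //= big1 ?addr0 // => p; rewrite (lt_pair2 p) eqxx.
Qed.

(** Lists the components of D_2 in the order dual to phi^1, phi^2, phi^3. *)
Lemma sum_D2_idx2 (V : nmodType) (F : D2_idx 2 -> V) :
  \sum_t F t = F (inl (p12, one2)) + F (inl (p12, two2)) + F (inr (p12, p12)).
Proof.
rewrite big_sumType /=; congr (_ + _).
  rewrite (eq_bigr (fun t => F (inl (t.1, t.2)))) => [|[] //].
  rewrite -(pair_bigA _ (fun p k => F (inl (p, k)))) sum_lt_pair2.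
  rewrite big_ord_recl big_ord1.
  by congr (F (inl (_, _)) + F (inl (_, _))); apply: val_inj.
rewrite (eq_bigr (fun t => F (inr (t.1, t.2)))) => [|[] //].
by rewrite -(pair_bigA _ (fun p q => F (inr (p, q)))) !sum_lt_pair2.
Qed.

(** Each A_{ij} occurs only in the component dual to phi^j; B_1 and B_2 each occur in two,
    undifferentiated against phi^1 or phi^2 and differentiated against phi^3. *)
Lemma D2_adjoint2 (R : realType) (M : lmodType {mpoly R[2]})
    (phi1 phi2 phi3 : M) (t : AB_idx 2) :
  op_act (ad (D2 R 2)) (potentials2 phi1 phi2 phi3) t
  = match t with
    | inl (i, j) =>
        let phi := if j == one2 then phi1 else phi2 in
        if i == one2 then - pd two2 phi else pd one2 phi
    | inr (r, _) =>
        if r == one2 then - pd two2 phi3 + phi1 else pd one2 phi3 + phi2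
    end.
Proof.
rewrite op_act_ad sum_D2_idx2 /= !mxE !enum_rankK /=.
(* In the plane an antisymmetric family has a single independent component, so every entry of [D2]
   becomes explicit. *)
have asymE (f : Defs.lt_pair 2 -> {mpoly R[2]}^o) i j :
    asym f i j = if i == j then 0 else if i == one2 then f p12 else - f p12.
  rewrite /asym; case: insubP => [p ij _|ij].
    by rewrite (lt_pair2 p); move: ij; case: i j => [[|[|i]] ?] [[|[|j]] ?].
  case: insubP => [p ji _|ji].
    by rewrite (lt_pair2 p); move: ji; case: i j {ij} => [[|[|i]] ?] [[|[|j]] ?].
  by move: ij ji; case: i j => [[|[|i]] ?] [[|[|j]] ?].
rewrite !asymE /= {asymE}.
have ord2 (i : 'I_2) : i = one2 \/ i = two2.
  by case: i => [[|[|i]] ?] //; [left|right]; apply: val_inj.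
have ringE := (@addr0, @add0r, @subr0, @sub0r, @oppr0, @opprK,
  @scale0r, @mulr0, @mulr1).
have pdE i (x : {mpoly R[2]}^o) : pd i x = 'X_i * x :> {mpoly R[2]} by [].
case: t => [[i j]|[r p]].
  by have [->|->] := ord2 i; have [->|->] := ord2 j;
     rewrite /= !pdE !ringE ?comp_mpolyN !comp_negX !comp_mpoly0 !ringE ?scaleNr.
rewrite (lt_pair2 p).
by have [->|->] := ord2 r; rewrite /= !pdE !ringE ?comp_mpolyN !comp_negX
     ?comp_mpoly0 comp_mpoly1 !ringE scale1r ?scaleNr addrC.
Qed.

(** * Cosserat equations, their parametrization, and the plane formulas *)

Theorem mainTheorem1 (R : realType) :
  (forall n : nat, (2 <= n)%N ->
    (* (1) *)
    (forall (M : lmodType {mpoly R[n]}) (sigma : 'I_n -> 'I_n -> M)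
            (mu : 'I_n -> 'I_n -> 'I_n -> M),
        (forall r i j, mu r i j = - mu r j i) ->
        (forall u : R1_idx n,
           op_act (ad (D1 R n)) (stress sigma mu) u = - cosserat sigma mu u) /\
        ((forall u : R1_idx n,
            op_act (ad (D1 R n)) (stress sigma mu) u = 0) <->
         (forall j, \sum_(i < n) pd i (sigma i j) = 0) /\
         (forall i j : 'I_n, (i < j)%N ->
            \sum_(r < n) pd r (mu r i j) + sigma i j - sigma j i = 0)))
    /\
    (* (2) *)
    [/\ op_order (ad (D2 R n)) = 1%N,
        (4 * #|{: D2_idx n}| = n ^ 2 * (n ^ 2 - 1))%N
      & parametrized_by (ad (D1 R n)) (ad (D2 R n))])
  /\
  (* (3) *)
  (forall (M : lmodType {mpoly R[2]}) (phi1 phi2 phi3 : M),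
     let y := op_act (ad (D2 R 2)) (potentials2 phi1 phi2 phi3) in
     let sigma i j := y (inl (i, j)) in
     let mu r := y (inr (r, p12)) in
     [/\ sigma one2 one2 = - pd two2 phi1,
         sigma one2 two2 = - pd two2 phi2,
         sigma two2 one2 = pd one2 phi1
       & sigma two2 two2 = pd one2 phi2] /\
     (mu one2 = - pd two2 phi3 + phi1 /\ mu two2 = pd one2 phi3 + phi2)).
Proof.
split=> [n n_gt1|M phi1 phi2 phi3 y sigma mu]; last first.
  by rewrite /mu /sigma /y !D2_adjoint2.
split=> [M sigma mu _|].
  split=> [u|]; first exact: D1_adjoint.
  (* The overall sign does not affect vanishing. *)
  split=> [ad0|[sigma0 mu0] u].
    split=> [j|i j ij].
      by have /eqP := ad0 (inl j); rewrite D1_adjoint oppr_eq0 => /eqP.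
    have /eqP := ad0 (inr (exist _ (i, j) ij)).
    by rewrite D1_adjoint oppr_eq0 => /eqP.
  rewrite D1_adjoint; apply/eqP; rewrite oppr_eq0; apply/eqP.
  by case: u => [j|[[i j] ij]] /=; [apply: sigma0 | apply: mu0].
split; [exact: order_ad_D2 | exact: card_D2_idx |].
by apply: generates_cc_ad => [x t|x]; [apply: D2_D1 | apply: D2_exact].
Qed.
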